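(* Let $S$ be a finite semigroup with principal series $S=S_1\supset S_2\supset\cdots\supset S_o\supset S_{o+1}=\emptyset$. Let $p\le o$ be such that the principal factor $S_p/S_{p+1}$ is CS-diagonal, $S_p/S_{p+1}\cong\mathcal{M}^0(G,n,m;P)$ and $(S_p/S_{p+1})/\eta^{*}\cong\mathcal{M}^0(G_{\eta^{*}},n_{\eta^{*}},n_{\eta^{*}};I_{n_{\eta^{*}}})$. Let $\Gamma$ be the minimal non-nilpotent representation of $S/S_{p+1}$ (with respect to its ideal $S_p/S_{p+1}$). Suppose there exist integers $k_1,k_2,k_3,k_4$ between $1$ and $n_{\eta^{*}}$ with $k_1\ne k_3$, and $v_1,v_2\in S\setminus S_{p+1}$, such that $$\Gamma(v_1)(k_1)=k_2,\quad \Gamma(v_1)(k_3)=k_4,\quad \Gamma(v_2)(k_1)=k_4,\quad \Gamma(v_2)(k_3)=k_2.$$ Then one of the following holds: (1) The $\eta^{*}$-root $S_{p'}/S_{p'+1}$ of the principal factor $S_p/S_{p+1}$ is such that $p'\ne p$, and $\phi_{\eta^{*}}(k_1)=\phi_{\eta^{*}}(k_3)$ and $\phi_{\eta^{*}}(k_2)=\phi_{\eta^{*}}(k_4)$, where $\phi_{\eta^*}(k)$ denotes the common value of $\phi_{\eta^*}$ on the elements of the class $\mathbb{I}_k$ of $\{1,\ldots,n\}$. (2) The $\eta^{*}$-root of the principal factor $S_p/S_{p+1}$ is $\theta$.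
   Context: For a semigroup $S$, $S^1$ denotes $S$ if $S$ has an identity, and $S$ with an identity $1$ adjoined otherwise. For $x,y,z_1,z_2,\ldots$ in $S^1$ define recursively $\lambda_0=x$, $\rho_0=y$, and $\lambda_{n+1}=\lambda_n z_{n+1}\rho_n$, $\rho_{n+1}=\rho_n z_{n+1}\lambda_n$, where $\lambda_n=\lambda_n(x,y,z_1,\ldots,z_n)$ and $\rho_n=\rho_n(x,y,z_1,\ldots,z_n)$. For a semigroup $S$ let $\eta_1=\{(x,x)\mid x\in S\}$ and, for every integer $n>1$, let $x\,\eta_n\,y$ if and only if there exist $z_1,\ldots,z_n\in S^1$ such that $x=\lambda_n(x,y,z_1,\ldots,z_n)$ and $y=\rho_n(x,y,z_1,\ldots,z_n)$. Let $\eta$ be the transitive closure of $\bigcup_{i\ge 1}\eta_i$, and let $\eta^{*}$ be the smallest congruence on $S$ containing $\eta$. Principal series: each $S_p$ is an ideal of $S$ and there is no ideal of $S$ strictly between $S_p$ and $S_{p+1}$ (the empty set counts as an ideal, and $S_o/\emptyset=S_o$). Each principal factor is completely $0$-simple, completely simple, or null (all products equal zero; in particular a factor $\{\theta\}$ is null). The zero of $S$, if it exists, is denoted $\theta$; if $S$ has no zero, no element is $\eta^*$-related to $\theta$. Rees matrix semigroups: $G$ is a finite group, $P=(p_{ji})$ is an $m\times n$ matrix with entries in $G\cup\{\theta\}$. The nonzero elements of $\mathcal{M}^0(G,n,m;P)$ are the triples $(g;i,j)$ with $g\in G$, $1\le i\le n$, $1\le j\le m$; the zero is $\theta$; the product is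 $(g;i,j)(h;k,l)=(g p_{jk} h;i,l)$ if $p_{jk}\ne\theta$ and $\theta$ otherwise. It is regular if every row and column of $P$ contains a nonzero entry. If $P$ has no zero entries, the nonzero elements form a completely simple semigroup $\mathcal{M}(G,n,m;P)$. Non-null principal factors are identified with such semigroups. A finite regular Rees matrix semigroup with sandwich matrix $P$ is CS-diagonal if for all $1\le r,r'\le m$, $1\le t,t'\le n$: whenever $p_{r,t},p_{r',t},p_{r,t'}$ are nonzero, $p_{r',t'}$ is nonzero. Then ''$i_\alpha,i_\beta\in\{1,\ldots,n\}$ are equivalent iff there is $j$ with $p_{j,i_\alpha}$ and $p_{j,i_\beta}$ nonzero'' is an equivalence relation with $n_{\eta^{*}}$ classes $\mathbb{I}_1,\ldots,\mathbb{I}_{n_{\eta^{*}}}$; put $\mathbb{I}'_l=\{j : p_{j,i}\neq\theta \text{ for some } i\in\mathbb{I}_l\}$. The $\mathbb{I}'_l$ partition $\{1,\ldots,m\}$, and for $i\in\mathbb{I}_g$, $j\in\mathbb{I}'_h$ one has $p_{j,i}\ne\theta$ iff $g=h$. The group $G_{\eta^{*}}$ is $(G/\eta^{*})/K$, with $G/\eta^*$ the quotient of $G$ by its own relation $\eta^*$ and $K$ the smallest normal subgroup of $G/\eta^{*}$ such that, for all $1\le a,b\le n_{\eta^*}$, the images of the entries of $P$ in the quotient satisfy $p_{x,c'}^{-1}p_{x,c}=p_{\beta,c'}^{-1}p_{\beta,c}$ and $p_{d,y}p_{d',y}^{-1}=p_{d,\alpha}p_{d',\alpha}^{-1}$ for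 all $c,c'\in\mathbb{I}_a$, $\beta,x\in\mathbb{I}'_a$, $\alpha,y\in\mathbb{I}_b$, $d,d'\in\mathbb{I}'_b$. $I_k$ is the $k\times k$ identity matrix. (The isomorphism $(S_p/S_{p+1})/\eta^{*}\cong\mathcal{M}^0(G_{\eta^{*}},n_{\eta^{*}},n_{\eta^{*}};I_{n_{\eta^{*}}})$, where $\eta^*$ is taken on $S_p/S_{p+1}$, serves to fix the notation.) Minimal non-nilpotent representation: if a semigroup $T$ has a CS-diagonal ideal $M=\mathcal{M}^0(G,n,m;P)$, then $\Gamma$ is the homomorphism from $T$ to the full transformation semigroup on $\{1,\ldots,n_{\eta^{*}}\}\cup\{\theta\}$ given by $\Gamma(s)(\theta)=\theta$ and, for $1\le i\le n_{\eta^{*}}$, $\Gamma(s)(i)=i'$ if $s(g;\alpha,\beta)=(g';\alpha',\beta)$ for some $g,g'\in G$, $\alpha\in\mathbb{I}_i$, $\alpha'\in\mathbb{I}_{i'}$, $1\le\beta\le m$, and $\Gamma(s)(i)=\theta$ otherwise (this is well defined). Here it is applied to $T=S/S_{p+1}$. $\eta^{*}$-root: let $S_p/S_{p+1}$ be a non-null principal factor, identified with a Rees matrix semigroup with group $G$, sizes $n,m$ and sandwich matrix $P$. If there is $a\in S_p\setminus S_{p+1}$ with $a\,\eta^{*}\,\theta$ ($\eta^*$ taken on $S$), the $\eta^{*}$-root of $S_p/S_{p+1}$ is $\theta$. Otherwise its $\eta^{*}$-root is the principal factor $S_{p'}/S_{p'+1}$ with $p\le p'\le o$ such that: (i) every $x\in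 S_p\setminus S_{p+1}$ is $\eta^{*}$-related to some $y\in S_{p'}\setminus S_{p'+1}$; (ii) no element of $(S_p\setminus S_{p+1})\cup(S_{p'}\setminus S_{p'+1})$ is $\eta^{*}$-related to an element of $S_{p'+1}$; (iii) $S_{p'}/S_{p'+1}$ is a CS-diagonal regular Rees matrix semigroup, with group $H$, sizes $n',m'$ and sandwich matrix $Q$; (iv) if $(g;\alpha,\beta),(g';\gamma,\lambda)\in S_p\setminus S_{p+1}$ with $p_{\beta,\gamma}\ne\theta$ are $\eta^{*}$-related respectively to $(h;i,j),(h';k,l)\in S_{p'}\setminus S_{p'+1}$, then $k\in\mathbb{I}_r$ and $j\in\mathbb{I}'_r$ for some $1\le r\le n'_{\eta^*}$ (classes associated with $Q$). Such a factor exists. When the root is $S_{p'}/S_{p'+1}$, the function $\phi_{\eta^{*}}:\{1,\ldots,n\}\to\{\mathbb{I}_1,\ldots,\mathbb{I}_{n'_{\eta^{*}}}\}$ (target: classes associated with $Q$) is defined by $\phi_{\eta^{*}}(\alpha)=\mathbb{I}_r$ whenever $(g;\alpha,\beta)\,\eta^{*}\,(h;i,j)$ for some $(g;\alpha,\beta)\in S_p\setminus S_{p+1}$ and $(h;i,j)\in S_{p'}\setminus S_{p'+1}$ with $i\in\mathbb{I}_r$; it is well defined, and, when $S_p/S_{p+1}$ is CS-diagonal, constant on each class of $\{1,\ldots,n\}$. *)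

(* Defs.v *)
From HB Require Import structures.
From Stdlib Require Import Relations.
From mathcomp Require Import all_boot all_fingroup matrix.

Set Implicit Arguments.
Unset Strict Implicit.
Unset Printing Implicit Defensive.

(* The join of [semigroupType] and [finType] cannot be declared outside the
   library: it would have to precede [finStarMonoidType] in the hierarchy. *)
HB.mixin Record Finite_isSemigroup S of Finite S := {
  smul : S -> S -> S;
  smulA : associative smul
}.

#[short(type="finSemigroupType")]
HB.structure Definition FinSemigroup := {S of Finite_isSemigroup S & Finite S}.

Notation "x ** y" := (smul x y) (at level 40, left associativity).

Section Semigroup.
Variable S : finSemigroupType.

Definition is_identity (e : S) := forall s : S, e ** s = s /\ s ** e = s.

Definition is_zero (z : S) := forall s : S, z ** s = z /\ s ** z = z.

(* S^1 is the part of [option S] cut out by [in_S1]: [None] is the adjoined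
   identity, present only if S has none of its own. *)
Definition in_S1 (z : option S) : Prop :=
  if z is None then ~ (exists e, is_identity e) else True.

Definition mul1 (x y : option S) : option S :=
  match x, y with
  | Some a, Some b => Some (a ** b)
  | None, _ => y
  | _, None => x
  end.

(* The pair (lambda_n, rho_n), where z lists z_1, ..., z_n. *)
Definition lambda_rho (x y : option S) (z : seq (option S)) :
    option S * option S :=
  foldl (fun lr zi => (mul1 (mul1 lr.1 zi) lr.2, mul1 (mul1 lr.2 zi) lr.1))
    (x, y) z.

Definition eta_ (n : nat) (x y : S) : Prop :=
  if n == 1 then x = y
  else 1 < n /\ exists z : seq (option S),
    [/\ size z = n, (forall i, i < n -> in_S1 (nth None z i)),
        Some x = (lambda_rho (Some x) (Some y) z).1
      & Some y = (lambda_rho (Some x) (Some y) z).2].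

Definition eta : S -> S -> Prop :=
  clos_trans S (fun x y => exists2 n, 1 <= n & eta_ n x y).

Definition congruence (R : S -> S -> Prop) : Prop :=
  equivalence S R
  /\ forall x y x' y', R x y -> R x' y' -> R (x ** x') (y ** y').

Definition eta_star (x y : S) : Prop :=
  forall R, congruence R -> (forall a b, eta a b -> R a b) -> R x y.

Definition ideal (J : {set S}) : Prop :=
  forall x s, x \in J -> s ** x \in J /\ x ** s \in J.

(* S = I 1, ..., I o, I o.+1 = set0; the values of I at other indices are
   irrelevant. *)
Definition principal_series (o : nat) (I : nat -> {set S}) : Prop :=
  [/\ I 1 = setT, I o.+1 = set0,
      (forall q, 1 <= q <= o.+1 -> ideal (I q)),
      (forall q, 1 <= q <= o -> I q.+1 \proper I q)
    & (forall q (K : {set S}), 1 <= q <= o -> ideal K ->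
         ~ ((I q.+1 \proper K) && (K \proper I q)))].

(* The Rees quotient A / J of an ideal A by an ideal J lives in [option S]:
   [Some x] with x in A outside J, and [None] for the zero theta, which is
   absent when J is empty, as A / set0 = A. *)
Definition rees_quotient (A J : {set S}) : {set option S} :=
  [set Some x | x in A :\: J] :|: (if J == set0 then set0 else [set None]).

Definition quotient_mul (J : {set S}) (x y : option S) : option S :=
  match x, y with
  | Some a, Some b => if a ** b \in J then None else Some (a ** b)
  | _, _ => None
  end.

Definition null_factor (A J : {set S}) : Prop :=
  exists2 z, z \in rees_quotient A J &
    {in rees_quotient A J &, forall x y, quotient_mul J x y = z}.

End Semigroup.

Section ReesMatrix.
Variables (G : finGroupType) (n m : nat).
Variable P : 'M[option G]_(m, n).  (* [None] is the entry theta *)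

(* Elements of M^0(G, n, m; P): [Some (g, i, j)] is (g; i, j), [None] is theta. *)
Definition rees_elt : finType := option (G * 'I_n * 'I_m)%type.

Definition rees_mul (x y : rees_elt) : rees_elt :=
  match x, y with
  | Some (g, i, j), Some (h, k, l) =>
      if P j k is Some a then Some ((g * a * h)%g, i, l) else None
  | _, _ => None
  end.

Definition regular : Prop :=
  (forall j, exists i, P j i != None) /\ (forall i, exists j, P j i != None).

Definition no_zero_entry : Prop := forall j i, P j i != None.

Definition CS_diagonal : Prop :=
  regular /\
  forall r r' t t', P r t != None -> P r' t != None -> P r t' != None ->
    P r' t' != None.

Definition same_class : rel 'I_n :=
  fun a b => [exists j, (P j a != None) && (P j b != None)].

Definition column_classes : {set {set 'I_n}} :=
  equivalence_partition same_class [set: 'I_n].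

Definition n_eta : nat := #|column_classes|.

Definition class_I (l : 'I_n_eta) : {set 'I_n} := enum_val l.

Definition class_I' (l : 'I_n_eta) : {set 'I_m} :=
  [set j | [exists i in class_I l, P j i != None]].

End ReesMatrix.

(* Rees coordinates on a principal factor: [elt (g, i, j)] is the element of S
   that is written (g; i, j). *)
Record rees_coordinates (S : finSemigroupType) := ReesCoordinates {
  grp : finGroupType;
  ncol : nat;
  nrow : nat;
  sandwich : 'M[option grp]_(nrow, ncol);
  elt : grp * 'I_ncol * 'I_nrow -> S
}.

Section Factors.
Variable S : finSemigroupType.

Definition magma_iso (X Y : finType) (A : {set X}) (opA : X -> X -> X)
    (B : {set Y}) (opB : Y -> Y -> Y) (f : X -> Y) : Prop :=
  [/\ f @: A = B, {in A &, injective f}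
    & {in A &, forall x y, f (opA x y) = opB (f x) (f y)}].

(* The coordinates D identify A / J with M^0(G, n, m; P), or, if J is empty
   (so that A / J need not have a zero), with M(G, n, m; P). As an isomorphism
   of semigroups with zero maps theta to theta, it has the form [omap elt]. *)
Definition identifies (A J : {set S}) (D : rees_coordinates S) : Prop :=
  regular (sandwich D) /\
  if J == set0 then
    no_zero_entry (sandwich D) /\
    magma_iso (~: [set None]) (rees_mul (sandwich D))
      (rees_quotient A J) (quotient_mul J) (omap (@elt S D))
  else
    magma_iso setT (rees_mul (sandwich D))
      (rees_quotient A J) (quotient_mul J) (omap (@elt S D)).

Definition classes_number (D : rees_coordinates S) : nat := n_eta (sandwich D).

(* The minimal non-nilpotent representation of T = S / J with respect to an
   ideal of T with coordinates D; s is an element of T, and [None] in the set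
   acted upon is theta. *)
Definition Gamma (J : {set S}) (D : rees_coordinates S) (s : option S)
    (x : option 'I_(classes_number D)) : option 'I_(classes_number D) :=
  if x is Some i then
    [pick i' | [exists g, exists g', exists a in class_I i,
                exists a' in class_I i', exists b,
                  quotient_mul J s (Some (elt (r := D) (g, a, b)))
                  == Some (elt (r := D) (g', a', b))]]
  else None.

Variables (o : nat) (I : nat -> {set S}) (D : nat -> rees_coordinates S).

Definition layer (q : nat) : {set S} := I q :\: I q.+1.

Definition root_is_zero (p : nat) : Prop :=
  exists2 a, a \in layer p & exists2 t, is_zero t & eta_star a t.

Definition root_is_factor (p p' : nat) : Prop :=
  [/\ ~ root_is_zero p, p <= p' <= o
    & [/\ (forall x, x \in layer p ->
             exists2 y, y \in layer p' & eta_star x y),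
          (forall x y, x \in layer p :|: layer p' -> y \in I p'.+1 ->
             ~ eta_star x y),
          ~ null_factor (I p') (I p'.+1) /\ CS_diagonal (sandwich (D p'))
        & (forall g al be g' ga la h i j h' k l,
             sandwich (D p) be ga != None ->
             eta_star (elt (r := D p) (g, al, be))
                      (elt (r := D p') (h, i, j)) ->
             eta_star (elt (r := D p) (g', ga, la))
                      (elt (r := D p') (h', k, l)) ->
             exists r : 'I_(classes_number (D p')),
               k \in class_I r /\ j \in class_I' r)]].

(* The defining property of phi_{eta^*}, the value r standing for the class
   I_r of the root; it determines phi. *)
Definition is_phi (p p' : nat)
    (phi : 'I_(ncol (D p)) -> 'I_(classes_number (D p'))) : Prop :=
  forall al r, phi al = r <->
    exists g be h i j,
      eta_star (elt (r := D p) (g, al, be)) (elt (r := D p') (h, i, j))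
      /\ i \in class_I r.

(* phi(k) = phi(k'), for the common values of phi on the k-th and k'-th
   classes. *)
Definition phi_agrees (p : nat) (C : Type) (phi : 'I_(ncol (D p)) -> C)
    (k k' : 'I_(classes_number (D p))) : Prop :=
  exists c, (forall al, al \in class_I k -> phi al = c) /\
            (forall al, al \in class_I k' -> phi al = c).

End Factors.

Arguments Gamma {S} J D s x.

(* Main.v *)
(* If a set of pairs is stable under (x, y) |-> (lambda_n, rho_n) for fixed
   z_1, ..., z_n, then it contains a periodic pair, and such a pair is
   eta-related. Applied to M^0(G, n, m; P) and z = (v2, v1), this relates some
   (g; a1, c2) to some (h; a3, c4), with a1, a3 in the classes k1, k3 and rows
   c2, c4 in the classes k2, k4. The root is the last layer p' that contains an
   element related to layer p: maximality makes the products of layer p' that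
   are related to elements of layer p nonzero, and p' is CS-diagonal because a
   violating 2 x 2 submatrix would, by the same periodicity argument, relate an
   element of layer p' to one of I p'.+1. Multiplying the related pair by
   suitable elements of layer p on the left gives p' <> p (as k1 <> k3), and on
   the right gives phi k2 = phi k4. *)
From Stdlib Require Import Relations Classical_Prop.
Require Import Defs.
From mathcomp Require Import all_boot all_fingroup matrix.

Set Implicit Arguments.
Unset Strict Implicit.
Unset Printing Implicit Defensive.

(** * The congruence [eta_star] and periodic pairs *)

Section EtaStar.
Variable S : finSemigroupType.
Implicit Types x y z : S.

Lemma eta_star_eta x y : eta x y -> eta_star x y.
Proof. by move=> xy R _; apply. Qed.

Lemma eta_star_refl x : eta_star x x.
Proof. by move=> R [[rR _ _] _] _; apply: rR. Qed.

Lemma eta_star_sym x y : eta_star x y -> eta_star y x.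
Proof.
move=> xy R cR sR; have [[_ _ symR] _] := cR.
by apply: symR; apply: xy.
Qed.

Lemma eta_star_trans x y z : eta_star x y -> eta_star y z -> eta_star x z.
Proof.
move=> xy yz R cR sR; have [[_ tR _] _] := cR.
by apply: tR (xy R cR sR) (yz R cR sR).
Qed.

Lemma eta_star_mul x y x' y' :
  eta_star x y -> eta_star x' y' -> eta_star (x ** x') (y ** y').
Proof. by move=> h h' R cR sR; apply: (cR.2); [apply: h | apply: h']. Qed.

(** The recursion for (lambda_n, rho_n) with each z_i taken in S itself, so that it becomes a
    self-map of the finite set S x S. *)
Definition malcev_step (xy : S * S) z : S * S :=
  (xy.1 ** z ** xy.2, xy.2 ** z ** xy.1).

Lemma lambda_rho_Some x y (w : seq S) :
  lambda_rho (Some x) (Some y) (map Some w) =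
  (Some (foldl malcev_step (x, y) w).1, Some (foldl malcev_step (x, y) w).2).
Proof. by elim: w x y => //= z w IHw x y; rewrite -IHw. Qed.

(* By finiteness some iterate of [foldl malcev_step ^~ w] is periodic. *)
Lemma eta_of_stable (X : S * S -> Prop) (w : seq S) (xy : S * S) :
  1 < size w -> (forall u, X u -> X (foldl malcev_step u w)) -> X xy ->
  exists u, X u /\ eta u.1 u.2.
Proof.
move=> w_gt1 Xw Xxy; pose f u := foldl malcev_step u w.
have Xiter k : X (iter k f xy) by elim: k => //= k; apply: Xw.
have /trajectP[k lt_k Ek] := looping_order f xy.
pose N := fingraph.order f xy - k; exists (iter k f xy); split=> //.
have N_gt0 : 0 < N by rewrite subn_gt0.
have Eflat M u : foldl malcev_step u (flatten (nseq M w)) = iter M f u.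
  by elim: M u => //= M IHM u; rewrite foldl_cat IHM -iterSr.
have Eper : iter N f (iter k f xy) = iter k f xy.
  by rewrite -iterD subnK ?(ltnW lt_k).
have sz : size (flatten (nseq N w)) = N * size w.
  by rewrite size_flatten /shape map_nseq sumn_nseq mulnC.
(* At index 1 [eta_] is mere equality, so the word must have at least two letters. *)
have sz_gt1 : 1 < N * size w by rewrite (leq_trans w_gt1) ?leq_pmull.
apply: t_step; exists (N * size w); first exact: ltnW.
rewrite /eta_ (gtn_eqF sz_gt1); split=> //.
exists (map Some (flatten (nseq N w))).
rewrite lambda_rho_Some -surjective_pairing Eflat Eper.
split=> //; first by rewrite size_map sz.
by move=> i lt_i; rewrite (nth_map xy.1) // sz.
Qed.

End EtaStar.

(** * Computation in the Rees coordinates of a principal factor *)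

Section Coordinates.
Variables (S : finSemigroupType) (A J : {set S}) (D : rees_coordinates S).
Hypothesis idD : identifies A J D.

Lemma elt_mul_quotient t u :
  quotient_mul J (Some (elt t)) (Some (elt u)) =
  omap (@elt S D) (rees_mul (sandwich D) (Some t) (Some u)).
Proof.
case: idD => _; case: ifP => _ [].
  by move=> _ [_ _ /(_ (Some t) (Some u)) ->]; rewrite // !inE.
by move=> _ _ /(_ (Some t) (Some u)) ->; rewrite // inE.
Qed.

Lemma elt_in t : elt (r := D) t \in A :\: J.
Proof.
suff: Some (elt t) \in rees_quotient A J.
  rewrite inE => /orP[/imsetP[x xAJ [->]] //|].
  by case: ifP; rewrite inE.
case: idD => _; case: ifP => _ [].
  by move=> _ [<- _ _]; apply/imsetP; exists (Some t); rewrite ?inE.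
by move=> <- _ _; apply/imsetP; exists (Some t); rewrite ?inE.
Qed.

Lemma elt_onto x : x \in A :\: J -> exists t, x = elt (r := D) t.
Proof.
move=> xAJ; have: Some x \in rees_quotient A J by rewrite inE imset_f.
case: idD => _; case: ifP => _ [].
  by move=> _ [<- _ _] /imsetP[[t|] // _ [->]]; exists t.
by move=> <- _ _ /imsetP[[t|] // _ [->]]; exists t.
Qed.

Lemma elt_inj : injective (@elt S D).
Proof.
move=> t u tu; apply: Some_inj; case: idD => _; case: ifP => _ [].
  by move=> _ [_ + _]; apply; rewrite ?inE //= tu.
by move=> _ + _; apply; rewrite ?inE //= tu.
Qed.

Lemma elt_mul g i j h k l a : sandwich D j k = Some a ->
  elt (g, i, j) ** elt (h, k, l) = elt ((g * a * h)%g, i, l).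
Proof.
move=> Pjk; have := elt_mul_quotient (g, i, j) (h, k, l).
by rewrite /= Pjk; case: ifP => //= _ [].
Qed.

Lemma elt_mul_None g i j h k l : sandwich D j k = None ->
  elt (g, i, j) ** elt (h, k, l) \in J.
Proof.
move=> Pjk; have := elt_mul_quotient (g, i, j) (h, k, l).
by rewrite /= Pjk; case: ifP.
Qed.

Lemma elt_mul_in g i j h k l :
  (elt (g, i, j) ** elt (h, k, l) \in A :\: J) = (sandwich D j k != None).
Proof.
case Pjk: (sandwich D j k) => [a|]; first by rewrite (elt_mul _ _ _ _ Pjk) elt_in.
by rewrite inE (elt_mul_None _ _ _ _ Pjk).
Qed.

Lemma layer_generates x y : x \in A :\: J -> y \in A :\: J ->
  exists a b, y = a ** x ** b.
Proof.
move=> /elt_onto[[[g i] j] ->] /elt_onto[[[h k] l] ->].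
have [[rowP colP] _] := idD.
have [i' +] := rowP j; case Pji: (sandwich D j i') => [a|] // _.
have [j' +] := colP i; case Pij: (sandwich D j' i) => [b|] // _.
(* Regularity supplies nonzero entries on both sides of x; the inverse cancels the group part: h b g
   a (b g a)^-1 = h. *)
exists (elt (h, k, j')), (elt (((b * g * a)^-1)%g, i', l)).
rewrite (elt_mul _ _ _ _ Pij) (elt_mul _ _ _ _ Pji).
by rewrite -!mulgA [X in (h * X)%g](_ : _ = 1%g) ?mulg1 // !mulgA mulgV.
Qed.

Lemma layer_idempotent x : x \in A :\: J ->
  exists2 e, e \in A :\: J & e ** e = e.
Proof.
move=> /elt_onto[[[g i] j] _]; have [[rowP _] _] := idD.
have [k +] := rowP j; case Pjk: (sandwich D j k) => [a|] // _.
exists (elt ((a^-1)%g, k, j)); first exact: elt_in.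
by rewrite (elt_mul _ _ _ _ Pjk) mulVg mul1g.
Qed.

(** Here [v], which may lie outside the layer, acts as a nonzero sandwich entry at row [j] and
    column [i]. The group part is left free because the stable sets of pairs only fix positions. *)
Definition links j v i := forall g k h l,
  exists g', elt (g, k, j) ** v ** elt (h, i, l) = elt (r := D) (g', k, l).

Lemma links_elt j g i k l :
  sandwich D j i != None -> sandwich D l k != None ->
  links j (elt (g, i, l)) k.
Proof.
case Pji: (sandwich D j i) => [a|] // _; case Plk: (sandwich D l k) => [b|] // _.
move=> g1 k1 h l1; rewrite (elt_mul _ _ _ _ Pji) (elt_mul _ _ _ _ Plk).
by eexists.
Qed.

(* One step with [w] exchanges the rows [c] and [d]; the step with [v]
   restores them. *)
Lemma eta_elt a b c d v w :
  links c w b -> links d w a -> links d v b -> links c v a ->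
  exists g h, eta (elt (r := D) (g, a, c)) (elt (h, b, d)).
Proof.
move=> cwb dwa dvb cva.
pose X u := exists g h, u = (elt (r := D) (g, a, c), elt (r := D) (h, b, d)).
have := @eta_of_stable _ X [:: w; v] (elt (1%g, a, c), elt (1%g, b, d)) isT.
case=> [_ [g [h ->]]||u [[g [h ->]] guh]]; last by exists g, h.
  rewrite /= /malcev_step /=.
  have [g1 ->] := cwb g a h d; have [h1 ->] := dwa h b g c.
  have [g2 ->] := dvb g1 a h1 c; have [h2 ->] := cva h1 b g1 d.
  by exists g2, h2.
by exists 1%g, 1%g.
Qed.

Lemma CS_diagonal_of_eta_star :
  (forall x y, x \in A :\: J -> y \in J -> ~ eta_star x y) ->
  CS_diagonal (sandwich D).
Proof.
move=> sepJ; split; first by case: idD.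
move=> r r' t t' Prt Pr't Prt'; apply/eqP => Pr't'.
(* Rows r and r' both meet column t, so the single element (1; t, r) serves as both letters.
   Multiplying the resulting pair by (1; t', r) on the right keeps the first member in the layer and
   sends the second into [J]. *)
have [g [h /eta_star_eta gh]] : exists g h,
    eta (elt (r := D) (g, t, r)) (elt (h, t, r')).
  by apply: (@eta_elt _ _ _ _ (elt (1%g, t, r)) (elt (1%g, t, r)));
    apply: links_elt.
have := eta_star_mul gh (eta_star_refl (elt (1%g, t', r))).
by apply: sepJ; rewrite ?elt_mul_in ?elt_mul_None.
Qed.

End Coordinates.

(** * Column classes of a CS-diagonal matrix *)

Section Classes.
Variables (G : finGroupType) (n m : nat) (P : 'M[option G]_(m, n)).
Hypothesis diagP : CS_diagonal P.

(** Transitivity is where CS-diagonality enters: entries (j,a), (j,b), (k,b), (k,c) nonzero force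
    (j,c) nonzero. *)
Lemma same_class_equiv : {in setT & &, equivalence_rel (same_class P)}.
Proof.
have [[_ colP] diag] := diagP.
have refl a : same_class P a a.
  by have [j Pja] := colP a; apply/existsP; exists j; rewrite Pja.
have sym a b : same_class P a b = same_class P b a.
  by apply: eq_existsb => j; rewrite andbC.
have trans a b c : same_class P a b -> same_class P b c -> same_class P a c.
  move=> /existsP[j /andP[ja jb]] /existsP[k /andP[kb kc]].
  by apply/existsP; exists j; rewrite ja (diag k j b c).
move=> a b c _ _ _; split=> // ab; apply/idP/idP; apply: trans => //.
by rewrite sym.
Qed.

Lemma class_I_exists a : exists l, a \in class_I (P := P) l.
Proof.
have /and3P[/eqP cov _ _] := equivalence_partitionP same_class_equiv.
have: a \in cover (column_classes P) by rewrite cov inE.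
move=> /bigcupP[C CP aC]; exists (enum_rank_in CP C).
by rewrite /class_I enum_rankK_in.
Qed.

Lemma class_I_nonempty l : exists a, a \in class_I (P := P) l.
Proof.
have /and3P[_ _ no0] := equivalence_partitionP same_class_equiv.
by apply/set0Pn; apply: contraNneq no0 => <-; apply: enum_valP.
Qed.

Lemma class_I_same l a b : a \in class_I (P := P) l ->
  same_class P a b = (b \in class_I l).
Proof.
have /and3P[_ triv _] := equivalence_partitionP same_class_equiv.
move=> al; rewrite -(@pblock_equivalence_partition _ _ setT) ?inE //;
  last exact: same_class_equiv.
by rewrite (def_pblock triv (enum_valP l) al).
Qed.

Lemma class_I_inj l l' a : a \in class_I (P := P) l -> a \in class_I l' -> l = l'.
Proof.
have /and3P[_ triv _] := equivalence_partitionP same_class_equiv.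
move=> al al'; apply: enum_val_inj.
by rewrite -(def_pblock triv (enum_valP l) al) (def_pblock triv (enum_valP l') al').
Qed.

(** Together with [class_I_common_row], this makes the support of each row exactly one class. *)
Lemma class_I_entry l a b j : a \in class_I (P := P) l -> b \in class_I l ->
  P j a != None -> P j b != None.
Proof.
have [_ diag] := diagP.
move=> al; rewrite -(class_I_same _ al) => /existsP[k /andP[ka kb]] ja.
exact: diag k j a b ka ja kb.
Qed.

Lemma class_I_common_row l a b j : a \in class_I (P := P) l ->
  P j a != None -> P j b != None -> b \in class_I l.
Proof.
move=> al ja jb; rewrite -(class_I_same _ al).
by apply/existsP; exists j; rewrite ja jb.
Qed.

End Classes.

(** [Gamma] gives one witness v (g0; a0, c) = (h0; b0, c). Row [j] meets [b0], so right
    multiplication by v turns row [j] into a row [j1] of the layer that meets [a0], hence the whole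
    class of [a0]. *)
Lemma Gamma_links (S : finSemigroupType) (A J : {set S})
    (D : rees_coordinates S) (v : S) (k k' : 'I_(classes_number D)) a b j :
  identifies A J D -> ideal A -> ideal J -> CS_diagonal (sandwich D) ->
  Gamma J D (Some v) (Some k) = Some k' ->
  a \in class_I k -> b \in class_I k' -> sandwich D j b != None ->
  links j v a.
Proof.
move=> idD idealA idealJ diag /=; case: pickP => // i Hi [Ei] ak bk' jb.
move: Hi; rewrite Ei => /existsP[g0 /existsP[h0 /existsP[a0 /andP[a0k]]]].
move=> /existsP[b0 /andP[b0k' /existsP[c /eqP/=]]].
case: ifP => // _ [E0] g nu h l.
set x := elt (g, nu, j).
have jb0 : sandwich D j b0 != None by apply: (class_I_entry diag bk').
have xvJ : x ** v \notin J.
  have: x ** elt (h0, b0, c) \in A :\: J by rewrite (elt_mul_in idD).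
  rewrite inE => /andP[+ _]; rewrite -E0 smulA.
  by apply: contra => /(idealJ _ (elt (g0, a0, c)))[].
have xvA : x ** v \in A.
  by have /setDP[xA _] := elt_in idD (g, nu, j); have [] := idealA x v xA.
have [[[g1 nu1] j1] E1] : exists t, x ** v = elt (r := D) t.
  by apply: (elt_onto idD); rewrite inE xvJ.
have [e0 Pjb0] : exists e, sandwich D j b0 = Some e.
  by case: (sandwich D j b0) jb0 => // e _; exists e.
have j1a0 : sandwich D j1 a0 != None.
  by rewrite -(elt_mul_in idD g1 nu1 j1 g0 a0 c) -E1 -smulA E0 (elt_mul_in idD).
(* Both bracketings of x v (g0; a0, c) have the same column coordinate. *)
have Enu : nu1 = nu.
  case Pj: (sandwich D j1 a0) j1a0 => [e|] // _.
  have := elt_mul idD g1 nu1 g0 c Pj.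
  by rewrite -E1 -smulA E0 (elt_mul idD _ _ _ _ Pjb0) => /(elt_inj idD)[].
have: sandwich D j1 a != None by apply: (class_I_entry diag a0k).
case Pj: (sandwich D j1 a) => [e|] // _.
by rewrite E1 (elt_mul idD _ _ _ _ Pj) Enu; eexists.
Qed.

Lemma max_index (Q : nat -> Prop) (p o : nat) : p <= o -> Q p ->
  exists p', [/\ p <= p' <= o, Q p' & forall q, p' < q <= o -> ~ Q q].
Proof.
elim: o => [|o IHo] le_po Qp.
  exists p; split=> //; first by rewrite leqnn.
  by move=> q /andP[lt_pq]; rewrite leqn0 => /eqP Eq; rewrite Eq in lt_pq.
have [Qo|nQo] := classic (Q o.+1).
  exists o.+1; split=> //; first by rewrite le_po /=.
  by move=> q /andP[/leq_trans h /h]; rewrite ltnn.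
move: le_po; rewrite leq_eqVlt => /predU1P[Epo|]; first by case: nQo; rewrite -Epo.
rewrite ltnS => /IHo /(_ Qp)[p' [/andP[pp' p'o] Qp' max]].
exists p'; split=> //; first by rewrite pp' leqW.
move=> q /andP[p'q]; rewrite leq_eqVlt => /predU1P[-> //|].
by rewrite ltnS => qo; apply: max; rewrite p'q.
Qed.

(** * The root as the last layer related to layer p *)

Section Root.
Variables (S : finSemigroupType) (o : nat) (I : nat -> {set S}).
Variables (D : nat -> rees_coordinates S) (p : nat).
Hypothesis series : principal_series o I.
Hypothesis coordinates : forall q, 1 <= q <= o ->
  ~ null_factor (I q) (I q.+1) -> identifies (I q) (I q.+1) (D q).
Hypothesis p_range : 1 <= p <= o.
Hypothesis p_nonnull : ~ null_factor (I p) (I p.+1).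
Hypothesis p_nonzero : ~ root_is_zero I p.

Let idp : identifies (I p) (I p.+1) (D p).
Proof. exact: coordinates. Qed.

Lemma series_layer q x : 1 <= q <= o.+1 -> x \in I q ->
  exists2 r, q <= r <= o & x \in layer I r.
Proof.
have [_ I0 _ _ _] := series.
move=> /andP[q_gt0 le_qo]; have [d Eo] : exists d, o.+1 = q + d.
  by exists (o.+1 - q); rewrite subnKC.
(* Induction on the distance from q to o+1, where the series is empty. *)
elim: d q q_gt0 le_qo Eo => [|d IHd] q q_gt0 le_qo Eo xq.
  by move: xq; rewrite -[q]addn0 -Eo I0 inE.
have lt_qo : q <= o by rewrite -ltnS Eo addnS ltnS leq_addr.
have [xq1|nxq1] := boolP (x \in I q.+1); last first.
  by exists q; rewrite ?leqnn // inE nxq1.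
have [|r /andP[qr ro] xr] := IHd q.+1 isT lt_qo _ xq1; first by rewrite addSnnS.
by exists r => //; rewrite ro ltnW.
Qed.

Definition meets q := exists x y,
  [/\ x \in layer I p, y \in layer I q & eta_star x y].

Lemma layer_p_nonempty : exists x, x \in layer I p.
Proof.
have [_ _ _ /(_ p p_range)] := series.
by case/properP=> _ [x xp nxp1] _; exists x; rewrite inE nxp1.
Qed.

Variable p' : nat.
Hypothesis p'_range : p <= p' <= o.
Hypothesis p'_meets : meets p'.
Hypothesis p'_max : forall q, p' < q <= o -> ~ meets q.

Let p'_range1 : 1 <= p' <= o.
Proof.
by case/andP: p_range => p1 _; case/andP: p'_range => /(leq_trans p1)->.
Qed.

Let ideal_p' : ideal (I p').
Proof.
have [_ _ h _ _] := series; apply: h; case/andP: p'_range1 => -> /=.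
exact: leqW.
Qed.

Let ideal_p'1 : ideal (I p'.+1).
Proof. by have [_ _ h _ _] := series; apply: h; case/andP: p'_range1. Qed.

Lemma root_separated x y : x \in layer I p -> y \in I p'.+1 -> ~ eta_star x y.
Proof.
move=> xp yJ xy.
have [|r /andP[lt_pr le_ro] yr] := series_layer _ yJ.
  by case/andP: p'_range1.
by apply: (p'_max (q := r)); [rewrite lt_pr | exists x, y].
Qed.

(** The form in which maximality is used: a product in [I p'] related to layer p cannot drop below
    layer p'. *)
Lemma root_in_layer x y : x \in layer I p -> y \in I p' -> eta_star x y ->
  y \in layer I p'.
Proof.
move=> xp yp' xy; rewrite inE yp' andbT; apply/negP=> yp'1.
exact: root_separated xp yp'1 xy.
Qed.

(** One related pair suffices: writing x as a x0 b relates it to a y0 b. *)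
Lemma root_covers x : x \in layer I p ->
  exists2 y, y \in layer I p' & eta_star x y.
Proof.
have [x0 [y0 [x0p y0p' xy0]]] := p'_meets.
move=> xp; have [a [b Ex]] := layer_generates idp x0p xp.
have xy : eta_star x (a ** y0 ** b).
  by rewrite Ex; do !apply: eta_star_mul => //; apply: eta_star_refl.
exists (a ** y0 ** b) => //; apply: root_in_layer xp _ xy.
have /setDP[y0I _] := y0p'.
by have [/(ideal_p' b)[_]] := ideal_p' a y0I.
Qed.

Lemma root_nonnull : ~ null_factor (I p') (I p'.+1).
Proof.
have [x xp] := layer_p_nonempty.
have [e ep ee] := layer_idempotent idp xp.
have [f fp' ef] := root_covers ep; have /setDP[fI nfJ] := fp'.
have eff : eta_star e (f ** f) by rewrite -ee; apply: eta_star_mul.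
have ffp' : f ** f \in layer I p'.
  by apply: root_in_layer ep _ eff; have [] := ideal_p' f fI.
have /setDP[_ nffJ] := ffp'.
have quot u : u \in layer I p' -> Some u \in rees_quotient (I p') (I p'.+1).
  by move=> up'; rewrite inE imset_f.
case=> z zq null; have := null _ _ (quot f fp') (quot f fp').
rewrite /= (negbTE nffJ) => Ez.
(* If [I p'.+1] is nonempty, the constant product must be theta, but f f is not. If it is empty, all
   products in the ideal [I p'] equal f f, which is then a zero of S related to e. *)
have [J0|Jn0] := eqVneq (I p'.+1) set0; last first.
  have Nq : None \in rees_quotient (I p') (I p'.+1).
    by rewrite !inE (negbTE Jn0) inE eqxx orbT.
  by have := null _ _ Nq Nq; rewrite -Ez.
have mul u w : u \in I p' -> w \in I p' -> u ** w = f ** f.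
  move=> uI wI; have qu a : a \in I p' -> Some a \in rees_quotient (I p') (I p'.+1).
    by move=> aI; apply: quot; rewrite /layer J0 setD0.
  by have := null _ _ (qu u uI) (qu w wI); rewrite /= J0 inE -Ez => -[].
apply: p_nonzero; exists e => //; exists (f ** f) => // s.
have [sf fs] := ideal_p' s fI.
by split; [rewrite -smulA | rewrite smulA]; apply: mul.
Qed.

Let idp' : identifies (I p') (I p'.+1) (D p').
Proof. by apply: coordinates => //; apply: root_nonnull. Qed.

(** Since y0 is a x b, a relation between x and y would relate x0 to a y b in [I p'.+1]. *)
Lemma root_separated_root x y :
  x \in layer I p' -> y \in I p'.+1 -> ~ eta_star x y.
Proof.
have [x0 [y0 [x0p y0p' xy0]]] := p'_meets.
move=> xp' yJ xy; have [a [b Ey0]] := layer_generates idp' xp' y0p'.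
apply: (@root_separated x0 (a ** y ** b)) => //.
  by have [/(ideal_p'1 b)[_]] := ideal_p'1 a yJ.
apply: (eta_star_trans xy0); rewrite Ey0.
by do !apply: eta_star_mul => //; apply: eta_star_refl.
Qed.

Lemma root_CS_diagonal : CS_diagonal (sandwich (D p')).
Proof. exact: CS_diagonal_of_eta_star idp' root_separated_root. Qed.

(** The product of the two elements of layer p stays in layer p, so the related product must stay in
    layer p'. *)
Lemma root_entry g al be g' ga la h i j h' k l :
  sandwich (D p) be ga != None ->
  eta_star (elt (r := D p) (g, al, be)) (elt (r := D p') (h, i, j)) ->
  eta_star (elt (r := D p) (g', ga, la)) (elt (r := D p') (h', k, l)) ->
  sandwich (D p') j k != None.
Proof.
move=> Pbega hij hkl.
rewrite -(elt_mul_in idp' h i j h' k l).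
apply: root_in_layer (eta_star_mul hij hkl); first by rewrite (elt_mul_in idp).
have /setDP[kl _] := elt_in idp' (h', k, l).
by have [] := ideal_p' (elt (h, i, j)) kl.
Qed.

Lemma root_is_factor_max : root_is_factor o I D p p'.
Proof.
split=> //; split.
- exact: root_covers.
- by move=> x y /setUP[]; [apply: root_separated | apply: root_separated_root].
- by split; [apply: root_nonnull | apply: root_CS_diagonal].
move=> g al be g' ga la h i j h' k l Pbega hij hkl.
have [r kr] := class_I_exists root_CS_diagonal k.
exists r; split=> //; rewrite inE; apply/exists_inP; exists k => //.
exact: root_entry Pbega hij hkl.
Qed.

Lemma root_covers_elt t : exists u,
  eta_star (elt (r := D p) t) (elt (r := D p') u).
Proof.
have [y /(elt_onto idp')[u ->] tu] := root_covers (elt_in idp t).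
by exists u.
Qed.

(** Well-definedness of phi: a row [d] meeting column [al] is carried to a row of the root that
    meets both i and i'. *)
Lemma root_same_class g al be h i j g' be' h' i' j'
    (r : 'I_(classes_number (D p'))) :
  eta_star (elt (r := D p) (g, al, be)) (elt (r := D p') (h, i, j)) ->
  eta_star (elt (r := D p) (g', al, be')) (elt (r := D p') (h', i', j')) ->
  i \in class_I r -> i' \in class_I r.
Proof.
move=> hij hij' ir.
have [[_ /(_ al)[d Pdal]] _] := idp.
have [[[w u] l] hwu] := root_covers_elt (1%g, al, d).
apply: (class_I_common_row root_CS_diagonal (j := l) ir).
  exact: root_entry Pdal hwu hij.
exact: root_entry Pdal hwu hij'.
Qed.

Lemma is_phi_exists : exists phi : 'I_(ncol (D p)) -> 'I_(classes_number (D p')),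
  is_phi phi.
Proof.
have [[_ colP] _] := idp.
have cls al : exists r : 'I_(classes_number (D p')), exists g be h i j,
    eta_star (elt (r := D p) (g, al, be)) (elt (r := D p') (h, i, j))
    /\ i \in class_I r.
  have [be _] := colP al; have [[[h i] j] hij] := root_covers_elt (1%g, al, be).
  by have [r ir] := class_I_exists root_CS_diagonal i; exists r, 1%g, be, h, i, j.
have [phi phiP] := fin_all_exists cls; exists phi => al r; split=> [<- //|].
move=> [g [be [h [i [j [hij ir]]]]]].
have [g' [be' [h' [i' [j' [hij' ir']]]]]] := phiP al.
by apply: (class_I_inj root_CS_diagonal ir'); apply: root_same_class hij hij' ir.
Qed.

Lemma is_phi_of_eta_star (phi : 'I_(ncol (D p)) -> 'I_(classes_number (D p')))
    g a c h b d : is_phi phi ->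
  eta_star (elt (r := D p) (g, a, c)) (elt (r := D p) (h, b, d)) ->
  phi a = phi b.
Proof.
move=> phiP ab; have [[[w i] j] bw] := root_covers_elt (h, b, d).
have [r ir] := class_I_exists root_CS_diagonal i.
rewrite (_ : phi b = r); last by apply/phiP; exists h, d, w, i, j.
apply/phiP; exists g, c, w, i, j; split=> //.
exact: eta_star_trans ab bw.
Qed.

(** Both related elements share one image (w; i, j) in the root, and its row j meets the images of
    columns a' and b'. *)
Lemma is_phi_of_eta_star_rows
    (phi : 'I_(ncol (D p)) -> 'I_(classes_number (D p'))) g a c h b d a' b' : is_phi phi ->
  eta_star (elt (r := D p) (g, a, c)) (elt (r := D p) (h, b, d)) ->
  sandwich (D p) c a' != None -> sandwich (D p) d b' != None ->
  phi a' = phi b'.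
Proof.
move=> phiP ab Pca' Pdb'.
have [[[w i] j] bw] := root_covers_elt (h, b, d).
have aw := eta_star_trans ab bw.
have [[[w1 i1] j1] a'w] := root_covers_elt (1%g, a', c).
(* The row c is an arbitrary choice; only the column b' matters. *)
have [[[w2 i2] j2] b'w] := root_covers_elt (1%g, b', c).
have [r i1r] := class_I_exists root_CS_diagonal i1.
have i2r : i2 \in class_I r.
  apply: (class_I_common_row root_CS_diagonal (j := j) i1r).
    exact: root_entry Pca' aw a'w.
  exact: root_entry Pdb' bw b'w.
rewrite (_ : phi b' = r); last by apply/phiP; exists 1%g, c, w2, i2, j2.
by apply/phiP; exists 1%g, c, w1, i1, j1.
Qed.

End Root.

Theorem theorem3p3 (S : finSemigroupType) (o : nat) (I : nat -> {set S})
    (D : nat -> rees_coordinates S) (p : nat)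
    (series : principal_series o I)
    (coordinates : forall q, 1 <= q <= o -> ~ null_factor (I q) (I q.+1) ->
       identifies (I q) (I q.+1) (D q))
    (p_range : 1 <= p <= o)
    (p_nonnull : ~ null_factor (I p) (I p.+1))
    (p_CS_diagonal : CS_diagonal (sandwich (D p)))
    (k1 k2 k3 k4 : 'I_(classes_number (D p))) (k13 : k1 <> k3)
    (v1 v2 : S) (v1_out : v1 \notin I p.+1) (v2_out : v2 \notin I p.+1)
    (v1k1 : Gamma (I p.+1) (D p) (Some v1) (Some k1) = Some k2)
    (v1k3 : Gamma (I p.+1) (D p) (Some v1) (Some k3) = Some k4)
    (v2k1 : Gamma (I p.+1) (D p) (Some v2) (Some k1) = Some k4)
    (v2k3 : Gamma (I p.+1) (D p) (Some v2) (Some k3) = Some k2) :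
  (exists p', [/\ root_is_factor o I D p p', p' <> p
    & exists phi : 'I_(ncol (D p)) -> 'I_(classes_number (D p')),
        [/\ is_phi phi, phi_agrees phi k1 k3 & phi_agrees phi k2 k4]])
  \/ root_is_zero I p.
Proof.
have [root0|nroot0] := classic (root_is_zero I p); [by right | left].
have idp := coordinates p p_range p_nonnull.
have [_ colP] := p_CS_diagonal.1.
have [x0 x0p] := layer_p_nonempty series p_range.
have [_ le_po] := andP p_range.
have [|p' [p'_range p'_meets p'_max]] := @max_index (meets I p) p o le_po.
  by exists x0, x0; split=> //; apply: eta_star_refl.
have [_ _ idealI _ _] := series.
have idealA : ideal (I p) by apply: idealI; case/andP: p_range => -> /leqW.
have idealJ : ideal (I p.+1) by apply: idealI; case/andP: p_range.
(* Columns and rows stay arbitrary within their classes, since agreement of phi concerns every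
   column of a class. *)
have eta13 a1 a3 c2 c4 a2 a4 : a1 \in class_I k1 -> a3 \in class_I k3 ->
    a2 \in class_I k2 -> a4 \in class_I k4 ->
    sandwich (D p) c2 a2 != None -> sandwich (D p) c4 a4 != None ->
  exists g h, eta_star (elt (r := D p) (g, a1, c2)) (elt (h, a3, c4)).
  move=> a1k a3k a2k a4k Pc2 Pc4.
  have GL v k k' a b j := @Gamma_links _ _ _ _ v k k' a b j idp idealA idealJ
    p_CS_diagonal.
  have [||||g [h /eta_star_eta gh]] :=
    @eta_elt _ (D p) a1 a3 c2 c4 v1 v2; last by exists g, h.
  - exact: GL v2k3 a3k a2k Pc2.
  - exact: GL v2k1 a1k a4k Pc4.
  - exact: GL v1k3 a3k a4k Pc4.
  - exact: GL v1k1 a1k a2k Pc2.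
have [a1 a1k] := class_I_nonempty p_CS_diagonal k1.
have [a2 a2k] := class_I_nonempty p_CS_diagonal k2.
have [a3 a3k] := class_I_nonempty p_CS_diagonal k3.
have [a4 a4k] := class_I_nonempty p_CS_diagonal k4.
have [c2 Pc2] := colP a2; have [c4 Pc4] := colP a4.
have [phi phiP] := is_phi_exists series coordinates p_range p_nonnull nroot0
  p'_range p'_meets p'_max.
exists p'; split.
- exact: root_is_factor_max.
- move=> Ep'; have [g [h gh]] := eta13 _ _ _ _ _ _ a1k a3k a2k a4k Pc2 Pc4.
  (* As k1 and k3 differ, row d meets a1 but not a3. Left multiplication by (1; a1, d) thus relates
     layer p to [I p.+1], which is excluded if p' = p. *)
  have [d Pd1] := colP a1.
  have Pd3 : sandwich (D p) d a3 = None.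
    apply/eqP; apply: contraT => Pd3; case: k13.
    apply: (class_I_inj p_CS_diagonal _ a3k).
    exact: class_I_common_row a1k Pd1 Pd3.
  have := eta_star_mul (eta_star_refl (elt (r := D p) (1%g, a1, d))) gh.
  apply: (root_separated series p_range p'_range p'_max).
    by rewrite /layer (elt_mul_in idp).
  by rewrite Ep' (elt_mul_None idp).
exists phi; split=> //.
- have E13 a b : a \in class_I k1 -> b \in class_I k3 -> phi a = phi b.
    move=> ak bk; have [g [h gh]] := eta13 _ _ _ _ _ _ ak bk a2k a4k Pc2 Pc4.
    exact: (is_phi_of_eta_star series coordinates p_range p_nonnull nroot0
      p'_range p'_meets p'_max phiP gh).
  exists (phi a3); split=> [a ak|b bk]; first exact: E13.
  (* Two columns of the class k3 are compared through a1, as [E13] only crosses between the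
     classes. *)
  by rewrite -(E13 a1) // (E13 a1 a3).
have E24 a b : a \in class_I k2 -> b \in class_I k4 -> phi a = phi b.
  (* The rows of the related pair are chosen to meet the given columns a and b. *)
  move=> ak bk; have [c Pca] := colP a; have [d Pdb] := colP b.
  have [g [h gh]] := eta13 _ _ _ _ _ _ a1k a3k ak bk Pca Pdb.
  exact: (is_phi_of_eta_star_rows series coordinates p_range p_nonnull nroot0
    p'_range p'_meets p'_max phiP gh Pca Pdb).
exists (phi a4); split=> [a ak|b bk]; first exact: E24.
by rewrite -(E24 a2) // (E24 a2 a4).
Qed.
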